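(* Let $\phi:[0,\infty)\times E_k\to E_k$ be a solution of a generalised system. Then the vector function $$F(t,\eta)=\frac{\phi(t,\eta)-\eta}{t}\qquad (t>1,\ \eta\in E_k)$$ is bounded and continuous, and for every $\eta\in E_k$ the limit set of $F(t,\eta)$, for $t\to+\infty$, coincides with $Q(\eta)$.
   Context: $E_k$ ($k\ge1$) denotes the space $\mathbb{R}^k$ with norm $\|X\|=\max_{1\le p\le k}|x_p|$. A solution of a generalised system is a (jointly) continuous function $\phi:[0,\infty)\times E_k\to E_k$ such that, with $\psi(\eta)=\phi(1,\eta)$, one has $\phi(0,\eta)=\eta$, $\phi(t,\eta+q)=\phi(t,\eta)+q$, $\psi(\eta+q)=\psi(\eta)+q$ and $\phi(t+1,\eta)=\phi(t,\psi(\eta))$ for all $t\ge0$, $\eta\in E_k$, $q\in\mathbb{Z}^k$. Put $\psi_0(\eta)=\eta$, $\psi_n(\eta)=\psi(\psi_{n-1}(\eta))$ for $n\ge1$, $a(\eta)=\psi(\eta)-\eta$, and $a_n(\eta)=a(\eta)+a(\psi(\eta))+\dots+a(\psi_{n-1}(\eta))$ for $n\ge 1$. The limit set of a sequence $B_n$ ($n\in\mathbb{N}$), respectively of a family $B_t$, is the set of all vectors $\gamma$ for which there are $n_p\in\mathbb{N}$, $n_p\to\infty$, with $\gamma=\lim B_{n_p}$, respectively $t_p\to\infty$ with $\gamma=\lim B_{t_p}$. $Q(\eta)$ denotes the limit set of the sequence $a_n(\eta)/n$. *)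

(* Defs.v *)
From HB Require Import structures.
From mathcomp Require Import all_boot all_order all_algebra.
From mathcomp Require Import all_classical all_reals all_analysis.

Set Implicit Arguments.
Unset Strict Implicit.
Unset Printing Implicit Defensive.

Import Order.TTheory GRing.Theory Num.Theory.
Import numFieldNormedType.Exports.
Local Open Scope classical_set_scope.
Local Open Scope ring_scope.

(* The topology and norm that the library puts on ['rV[R]_k] are those of the
   maximum norm [`|x| = max_p `|x 0 p|]. *)

Section GeneralisedSystem.
Context {R : realType} {k : nat}.
Local Notation E := 'rV[R]_k.
Implicit Types (phi : R -> E -> E) (eta : E).

Definition time_one phi eta : E := phi 1 eta.

(* A function on [0, +oo[ x E is encoded as a total function whose values at
   negative times are never constrained; an integer vector [q : 'rV[int]_k] is
   embedded in E by [map_mx intr]. *)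
Record generalised_solution phi : Prop := GeneralisedSolution {
  gsol_continuous :
    {within [set z : R * E | 0 <= z.1], continuous (fun z => phi z.1 z.2)} ;
  gsol_initial : forall eta, phi 0 eta = eta ;
  gsol_periodic : forall t eta (q : 'rV[int]_k), 0 <= t ->
    phi t (eta + map_mx intr q) = phi t eta + map_mx intr q ;
  gsol_time_one_periodic : forall eta (q : 'rV[int]_k),
    time_one phi (eta + map_mx intr q) = time_one phi eta + map_mx intr q ;
  gsol_shift : forall t eta, 0 <= t ->
    phi (t + 1) eta = phi t (time_one phi eta)
}.

Definition displacement phi eta : E := time_one phi eta - eta.

Definition displacement_sum phi (n : nat) eta : E :=
  \sum_(0 <= i < n) displacement phi (iter i (time_one phi) eta).

Definition mean_velocity phi (t : R) eta : E := t^-1 *: (phi t eta - eta).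

(* Sequences are indexed by the positive integers. *)
Definition limit_set_seq (B : nat -> E) : set E :=
  [set gamma | exists n : nat -> nat,
    [/\ forall p, (0 < n p)%N, n @ \oo --> \oo & (B \o n) @ \oo --> gamma]].

(* [D] is the index set of the family. *)
Definition limit_set_family (D : set R) (B : R -> E) : set E :=
  [set gamma | exists t : nat -> R,
    [/\ forall p, D (t p), t @ \oo --> +oo & (B \o t) @ \oo --> gamma]].

Definition rotation_set phi eta : set E :=
  limit_set_seq (fun n => n%:R^-1 *: displacement_sum phi n eta).

End GeneralisedSystem.

(* Main.v *)
Require Import Defs.
From HB Require Import structures.
From mathcomp Require Import all_boot all_order all_algebra.
From mathcomp Require Import all_classical all_reals all_analysis.
From mathcomp Require Import ring lra.

Set Implicit Arguments.
Unset Strict Implicit.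
Unset Printing Implicit Defensive.

Import Order.TTheory GRing.Theory Num.Theory.
Import numFieldNormedType.Exports.
Local Open Scope classical_set_scope.
Local Open Scope ring_scope.

(** The whole statement rests on one a priori bound: a solution moves a point
by at most a constant [C] during a unit of time, uniformly in the starting
point ([unit_time_displacement_bounded]).  Indeed [phi s eta - eta] is
invariant under integer translations of [eta], so its values over
[[0, 1] x E] are those over the compact set [[0, 1] x [0, 1]^k], where it is
continuous.

Write [t = n + s] with [n] a natural number and [0 <= s <= 1].  The shift
property turns [phi t eta] into [phi s] of the [n]-th iterate of the time-one
map, and the displacements along that orbit telescope, so that
[phi t eta - eta] is the sum of [a_n(eta)] and of a vector of norm at most [C],
while [a_n(eta)] itself has norm at most [n C].  The first fact with the second
gives [|F(t, eta)| <= 2 C] for [t > 1], and also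
[|F(t, eta) - a_n(eta) / n| <= 2 C / t] ([mean_velocity_approx]).  Hence along
times and integers that stay within distance 1 and tend to infinity the two
averages have the same limits: from times [t_p] one passes to their integer
parts, from integers [n_p] to the times [n_p + 1]. *)

Section GeneralisedSolution.
Context {R : realType} {k : nat}.
Context (phi : R -> 'rV[R]_k -> 'rV[R]_k).
Context (hphi : generalised_solution phi).
Implicit Types (eta : 'rV[R]_k) (s t : R) (n : nat).

Local Notation psi := (time_one phi).

(** Continuity holds only on the closed half space of nonnegative times, so it
is restricted to subsets of it rather than used pointwise. *)
Lemma displacement_within_continuous (D : set (R * 'rV[R]_k)) :
  D `<=` [set z | 0 <= z.1] ->
  {within D, continuous (fun z => phi z.1 z.2 - z.2)}.
Proof.
move=> D0; apply: within_continuousB.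
  exact: continuous_subspaceW D0 (gsol_continuous hphi).
by apply: continuous_subspaceT => z; exact: cvg_snd.
Qed.

Lemma unit_time_displacement_bounded :
  exists C : R, forall s eta, 0 <= s <= 1 -> `|phi s eta - eta| <= C.
Proof.
pose cube : set 'rV[R]_k := [set v | forall i, `[0, 1]%classic (v ord0 i)].
have cptD : compact (`[0, 1]%classic `*` cube : set (R * 'rV[R]_k)).
  apply: compact_setX; first exact: segment_compact.
  exact: (@rV_compact R k (fun=> `[0, 1]%classic)
    (fun=> @segment_compact R 0 1)).
have D0 : (`[0, 1]%classic `*` cube : set (R * 'rV[R]_k)) `<=`
    [set z | 0 <= z.1].
  by move=> [s v] [/=]; rewrite in_itv /= => /andP[].
have [M [_ bndM]] := compact_bounded
  (continuous_compact (displacement_within_continuous D0) cptD).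
exists (M + 1) => s eta s01.
(* Translating by minus the integer part brings the point into the unit cube. *)
pose q : 'rV[int]_k := - map_mx Num.floor eta.
have -> : phi s eta - eta =
    phi s (eta + map_mx intr q) - (eta + map_mx intr q).
  by case/andP: s01 => s0 _; rewrite (gsol_periodic hphi)// opprD addrACA subrr addr0.
apply: (bndM (M + 1)); first by rewrite ltrDl.
exists (s, eta + map_mx intr q) => //; split => [/=|i /=].
  by rewrite in_itv.
rewrite in_itv /= !mxE rmorphN /= subr_ge0 floor_le_tmp /=.
by rewrite lerBlDl -intrD1 ltW// floorD1_gt.
Qed.

Lemma gsol_shift_iter n t eta : 0 <= t ->
  phi (n%:R + t) eta = phi t (iter n psi eta).
Proof.
elim: n eta => [|n IHn] eta t0; first by rewrite add0r.
rewrite -natr1 addrAC (gsol_shift hphi) ?addr_ge0//.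
by rewrite IHn// -iterSr.
Qed.

Lemma displacement_sumE n eta :
  displacement_sum phi n eta = iter n psi eta - eta.
Proof.
exact: (telescope_sumr (fun i => iter i psi eta) (leq0n n)).
Qed.

Lemma displacement_split n s eta : 0 <= s ->
  phi (n%:R + s) eta - eta =
  displacement_sum phi n eta
  + (phi s (iter n psi eta) - iter n psi eta).
Proof.
by move=> s0; rewrite gsol_shift_iter// displacement_sumE [RHS]addrC subrKA.
Qed.

Section Bounded.
Context (C : R) (hC : forall s eta, 0 <= s <= 1 -> `|phi s eta - eta| <= C).

Lemma displacement_bound_ge0 : 0 <= C.
Proof.
by apply: le_trans (normr_ge0 _) (hC (s := 0) 0 _); rewrite lexx ler01.
Qed.

Lemma norm_displacement_sum_le n eta :
  `|displacement_sum phi n eta| <= n%:R * C.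
Proof.
rewrite mulr_natl -[n in leRHS]subn0 -sumr_const_nat.
apply: le_trans (ler_norm_sum _ _ _) _; apply: ler_sum => i _.
by rewrite hC ?ler01 ?lexx.
Qed.

Lemma norm_mean_velocity_le t eta : 1 < t ->
  `|mean_velocity phi t eta| <= 2 * C.
Proof.
move=> t1; have t0 : 0 < t by exact: lt_trans t1.
have /andP[nt /ltW tn] := truncn_itv (ltW t0).
set n := Num.truncn t in nt tn.
have s01 : 0 <= t - n%:R <= 1 by rewrite subr_ge0 nt lerBlDl natr1.
have -> : mean_velocity phi t eta = t^-1 *: (displacement_sum phi n eta
    + (phi (t - n%:R) (iter n psi eta) - iter n psi eta)).
  by rewrite -displacement_split ?subrKC//; case/andP: s01.
rewrite normrZ gtr0_norm ?invr_gt0// mulrC ler_pdivrMr//.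
apply: le_trans (ler_normD _ _) _.
apply: le_trans (lerD (norm_displacement_sum_le n eta) (hC _ s01)) _.
have := displacement_bound_ge0; nra.
Qed.

(** With [t = n + s], two errors of size at most [C / t] add up: the motion
during the last, incomplete unit of time, and the change of normalisation from
[1 / n] to [1 / t].  The latter differ by [s / (t n)] and multiply a vector of
norm at most [n C]. *)
Lemma mean_velocity_approx n s eta : (0 < n)%N -> 0 <= s <= 1 ->
  `|mean_velocity phi (n%:R + s) eta - n%:R^-1 *: displacement_sum phi n eta|
  <= 2 * C * (n%:R + s)^-1.
Proof.
move=> n0 s01; have /andP[s0 s1] := s01.
have n0R : 0 < n%:R :> R by rewrite ltr0n.
have t0 : 0 < n%:R + s by rewrite ltr_wpDr.
rewrite /mean_velocity displacement_split// scalerDr addrAC -scalerBl addrC.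
apply: le_trans (ler_normD _ _) _; rewrite !normrZ.
rewrite [`|(_ + _)^-1|]gtr0_norm ?invr_gt0//.
have -> : `|(n%:R + s)^-1 - n%:R^-1| = s * (n%:R + s)^-1 * n%:R^-1.
  rewrite distrC ger0_norm; first by field; rewrite !gt_eqF.
  by rewrite subr_ge0 lef_pV2 ?posrE// lerDl.
have -> : 2 * C / (n%:R + s) = (n%:R + s)^-1 * C + (n%:R + s)^-1 * C by ring.
apply: lerD; first by rewrite ler_wpM2l ?invr_ge0 ?(ltW t0)// hC.
rewrite -!mulrA; apply: le_trans (ler_piMl _ s1) _.
  by rewrite !mulr_ge0 ?invr_ge0// ltW.
rewrite ler_wpM2l ?invr_ge0 ?(ltW t0)//.
by rewrite mulrC ler_pdivrMr// mulrC norm_displacement_sum_le.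
Qed.

(** The form in which the estimate serves both inclusions of limit sets; the
interval of length 1 is closed on both sides so as to allow [t p = n p + 1]. *)
Lemma mean_velocity_close_cvg (n : nat -> nat) (t : nat -> R) eta :
  (forall p, (0 < n p)%N) -> (forall p, 0 <= t p - (n p)%:R <= 1) ->
  t @ \oo --> +oo ->
  (fun p => mean_velocity phi (t p) eta
            - (n p)%:R^-1 *: displacement_sum phi (n p) eta) @ \oo
    --> (0 : 'rV[R]_k).
Proof.
move=> n0 nt too; apply: norm_cvg0.
have t0 p : 0 < t p.
  have /andP[+ _] := nt p; rewrite subr_ge0.
  by apply: lt_le_trans; rewrite ltr0n.
apply: (@squeeze_cvgr _ _ _ _ (cst 0) (fun p => 2 * C * (t p)^-1)).
- near=> p; rewrite normr_ge0/=.
  by have := mean_velocity_approx eta (n0 p) (nt p); rewrite subrKC.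
- exact: cvg_cst.
- rewrite -(mulr0 (2 * C)); apply: cvgMl_tmp.
  by apply/gtr0_cvgV0 => //; near=> p; exact: t0.
Unshelve. all: by end_near. Qed.

Lemma limit_set_mean_velocity eta :
  limit_set_family [set t | 1 < t] (fun t => mean_velocity phi t eta)
  = rotation_set phi eta.
Proof.
apply/seteqP; split=> gamma.
- move=> [t [t1 too tl]]; exists (fun p => Num.truncn (t p)).
  have n0 p : (0 < Num.truncn (t p))%N by rewrite truncn_gt0 ltW// t1.
  split=> //.
    apply/cvgnyPge => A; have /cvgryPge/(_ A%:R) := too.
    apply: filterS => p At; rewrite truncn_ge_nat//.
    by rewrite (le_trans ler01)// ltW// t1.
  have nt p : 0 <= t p - (Num.truncn (t p))%:R <= 1.
    have /truncn_itv/andP[h1 h2] : 0 <= t p.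
      by rewrite (le_trans ler01)// ltW// t1.
    by rewrite subr_ge0 h1 lerBlDl natr1 ltW.
  have /(_ eventually_filter) := cvgB tl (mean_velocity_close_cvg eta n0 nt too).
  rewrite subr0; apply: cvg_trans; apply: near_eq_cvg.
  by near=> p; rewrite /= !fctE subKr.
- move=> [n [n0 noo nl]].
  (* Adding 1 keeps the times above 1 even where [n p = 1]. *)
  exists (fun p => (n p)%:R + 1).
  have nt p : 0 <= ((n p)%:R + 1 : R) - (n p)%:R <= 1.
    by rewrite addrAC subrr add0r ler01 lexx.
  have too : (fun p => (n p)%:R + 1 : R) @ \oo --> +oo.
    apply: (ger_cvgy _ ((cvgrnyP n).2 noo)).
    by near=> p; rewrite lerDl.
  split=> //; first by move=> p; rewrite /= ltrDr ltr0n.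
  exact: cvg_sub0 (mean_velocity_close_cvg eta n0 nt too) nl.
Unshelve. all: by end_near. Qed.

End Bounded.

Lemma mean_velocity_within_continuous :
  {within [set z : R * 'rV[R]_k | 1 < z.1],
    continuous (fun z => mean_velocity phi z.1 z.2)}.
Proof.
have D0 : [set z : R * 'rV[R]_k | 1 < z.1] `<=` [set z | 0 <= z.1].
  by move=> z /= /ltW; apply: le_trans.
have oD : open [set z : R * 'rV[R]_k | 1 < z.1].
  apply: (@open_comp _ _ fst [set t : R | 1 < t]); last exact: open_gt.
  by move=> z _; exact: cvg_fst.
have := displacement_within_continuous D0.
rewrite !continuous_open_subspace// => cD z zD.
apply: cvgZ; last exact: cD.
apply: cvgV; last exact: cvg_fst.
by move: zD; rewrite inE /= => /(lt_trans ltr01) /gt_eqF ->.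
Qed.

End GeneralisedSolution.

Theorem theorem3p9 (R : realType) (k : nat) (hk : (1 <= k)%N)
    (phi : R -> 'rV[R]_k -> 'rV[R]_k) (hphi : generalised_solution phi) :
  [/\ exists M : R, forall (t : R) (eta : 'rV[R]_k),
        1 < t -> `|mean_velocity phi t eta| <= M,
      {within [set z : R * 'rV[R]_k | 1 < z.1],
        continuous (fun z => mean_velocity phi z.1 z.2)}
    & forall eta : 'rV[R]_k,
        limit_set_family [set t | 1 < t] (fun t => mean_velocity phi t eta)
        = rotation_set phi eta].
Proof.
have [C hC] := unit_time_displacement_bounded hphi.
split.
- by exists (2 * C) => t eta; exact: norm_mean_velocity_le.
- exact: mean_velocity_within_continuous.
- exact: (limit_set_mean_velocity hphi hC).
Qed.
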